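(* Let $(\mathcal M,[\,,\,],\langle\,,\,\rangle)$ be a Euclidean solvable Malcev algebra. Then $(\mathcal M,[\,,\,],\langle\,,\,\rangle)$ is flat (as a Malcev algebra, i.e. $K=0$) if and only if $\mathcal M$ splits as $$\mathcal M=[\mathcal M,\mathcal M]^{\perp}\oplus[\mathcal M,\mathcal M],$$ where $[\mathcal M,\mathcal M]^{\perp}$ and $[\mathcal M,\mathcal M]$ are abelian, and $\mathrm{ad}_u$ is skew-symmetric with respect to $\langle\,,\,\rangle$ for every $u\in[\mathcal M,\mathcal M]^{\perp}$. Furthermore, in this case, the dimension of $[\mathcal M,\mathcal M]$ is even.
   Context: All vector spaces are finite dimensional; here the base field is $\mathbb R$. A Malcev algebra is a vector space $\mathcal M$ with an anti-symmetric bilinear bracket satisfying $J(u,v,[u,w])=[J(u,v,w),u]$ for all $u,v,w$, where $J(u,v,w)=[[u,v],w]+[[w,u],v]+[[v,w],u]$. A Euclidean Malcev algebra is a real Malcev algebra with a positive definite symmetric bilinear form $\langle\,,\,\rangle$. The Levi-Civita product $\bullet$ is defined by $2\langle u\bullet v,w\rangle=\langle[u,v],w\rangle-\langle[v,w],u\rangle+\langle[w,u],v\rangle$, and $\mathrm L_u(v)=u\bullet v$. The curvature is $$K(u,v,w)=\mathrm L_{[[u,v],w]}-\mathrm L_{[u,w]}\circ\mathrm L_v-\mathrm L_u\circ\mathrm L_{[v,w]}+\mathrm L_v\circ\mathrm L_u\circ\mathrm L_w-\mathrm L_w\circ\mathrm L_v\circ\mathrm L_u,$$ and the Malcev algebra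 is called flat if $K(u,v,w)=0$ for all $u,v,w\in\mathcal M$. Here $\mathrm{ad}_u(v)=[u,v]$, $[\mathcal M,\mathcal M]$ is the span of all brackets (derived ideal), $\perp$ is the orthogonal with respect to $\langle\,,\,\rangle$, and a subspace is abelian if the bracket of any two of its elements is zero. *)

(* Defs.v *)
From HB Require Import structures.
From mathcomp Require Import all_boot all_order all_algebra.
From mathcomp Require Import all_classical all_reals.
From mathcomp Require Import ring.

Set Implicit Arguments.
Unset Strict Implicit.
Unset Printing Implicit Defensive.

Import Order.TTheory GRing.Theory Num.Theory.
Local Open Scope ring_scope.

Section Malcev.
Variables (R : realType) (M : vectType R) (br : {bilinear M -> M -> M}).
Implicit Types (u v w : M) (U V W : {vspace M}).

Local Notation "'[ u , v ]" := (br u v)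
  (format "''[' u ,  v ]").

Definition jacobian u v w : M :=
  '['[u, v], w] + '['[w, u], v] + '['[v, w], u].

Definition is_malcev : Prop :=
  (forall u v, '[u, v] = - '[v, u]) /\
  (forall u v w, jacobian u v '[u, w] = '[jacobian u v w, u]).

(* The generators are only the brackets of basis vectors; by mem_brackv and
   brackv_sub, brackv U V is the span of all brackets of U with V. *)
Definition brackv U V : {vspace M} :=
  <<[seq '[u, v] | u <- vbasis U, v <- vbasis V]>>%VS.

Definition derived_ideal : {vspace M} := brackv fullv fullv.

Definition derived_series (n : nat) : {vspace M} :=
  iter n (fun U => brackv U U) fullv.

Definition is_solvable : Prop := exists n, derived_series n = 0%VS.

Definition abelian_subspace U : Prop := {in U &, forall u v, '[u, v] = 0}.

Lemma mem_brackv U V u v : u \in U -> v \in V -> '[u, v] \in brackv U V.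
Proof.
move=> /coord_vbasis-> /coord_vbasis->.
rewrite linear_sumlz; apply: memv_suml => i _ /=.
rewrite linear_sumr; apply: memv_suml => j _ /=.
rewrite linearZl_LR linearZr_LR; apply/memvZ/memvZ/memv_span.
by apply: allpairs_f; apply: mem_nth; rewrite size_tuple.
Qed.

Lemma brackv_sub U V W :
  {in U & V, forall u v, '[u, v] \in W} -> (brackv U V <= W)%VS.
Proof.
move=> sub; apply/span_subvP => _ /allpairsP[[u v] /= [Uu Vv ->]].
by apply: sub; apply: vbasis_mem.
Qed.

Variable ip : {dot M for idfun}.

Local Notation "'< u , v >" := (ip u v)
  (v at level 69, format "''<' u ,  v >").

Definition skew_wrt (f : M -> M) : Prop :=
  forall v w, '<f v, w> = - '<v, f w>.

Definition koszul u v w : R :=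
  '<'[u, v], w> - '<'[v, w], u> + '<'[w, u], v>.

(* xget 0 selects the vector p such that 2 <p, w> = koszul u v w for all w; it
   exists and is unique by levi_civitaP and levi_civita_unique. *)
Definition levi_civita u v : M :=
  xget 0 [set p | forall w, 2 * '<p, w> = koszul u v w]%classic.

Local Notation L := levi_civita.

Definition curvature u v w : M -> M := fun x =>
  L '['[u, v], w] x - L '[u, w] (L v x) - L u (L '[v, w] x)
  + L v (L u (L w x)) - L w (L v (L u x)).

Definition is_flat : Prop := forall u v w x, curvature u v w x = 0.

Lemma dot_inj p q : (forall w, '<p, w> = '<q, w>) -> p = q.
Proof.
move=> pq; apply/eqP; rewrite -subr_eq0; apply/negP => /negP npq.
have := neq0_dnorm_gt0 (s := ip) _ npq.
by rewrite linearBl /= pq subrr ltxx.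
Qed.

Lemma riesz (f : M -> R^o) : linear f -> exists p, forall w, '<p, w> = f w.
Proof.
move=> f_lin.
pose fL : {linear M -> R^o} :=
  HB.pack f (GRing.isLinear.Build _ _ _ _ f f_lin).
have ip_lin p : linear (ip p : M -> R^o) by move=> a x y; rewrite linearPr.
pose ipL p : {linear M -> R^o} :=
  HB.pack (ip p : M -> R^o) (GRing.isLinear.Build _ _ _ _ _ (ip_lin p)).
pose phi p : 'Hom(M, R^o) := linfun (ipL p).
have phiE p w : phi p w = '<p, w> by rewrite /phi lfunE.
have phi_lin : linear phi.
  move=> a p q; apply/lfunP => w.
  by rewrite add_lfunE scale_lfunE !phiE linearPl.
pose phiL : {linear M -> 'Hom(M, R^o)} :=
  HB.pack phi (GRing.isLinear.Build _ _ _ _ phi phi_lin).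
have ker0 : lker (linfun phiL) == 0%VS.
  apply/lker0P => p q; rewrite !lfunE /= => pq.
  by apply: dot_inj => w; rewrite -!phiE pq.
have im : limg (linfun phiL) = fullv.
  apply/eqP; rewrite eqEdim subvf /= limg_dim_eq; last first.
    by rewrite (eqP ker0) capv0.
  by rewrite !dimvf /dim /= muln1.
have : linfun fL \in limg (linfun phiL) by rewrite im memvf.
move=> /memv_imgP[p _]; rewrite lfunE /= => fp.
by exists p => w; rewrite -phiE -fp; exact: (lfunE fL).
Qed.

Lemma levi_civitaP u v w : 2 * '<L u v, w> = koszul u v w.
Proof.
have lin : linear (fun w => 2^-1 * koszul u v w : R^o).
  move=> a x y; rewrite /koszul !(linearPr, linearPl) /=.
  by rewrite /GRing.scale /=; ring.
have [p pE] := riesz lin.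
have ex : exists p, forall x, 2 * '<p, x> = koszul u v x.
  by exists p => x; rewrite pE mulVKf ?pnatr_eq0.
exact: (xgetPex 0 ex).
Qed.

Lemma levi_civita_unique u v p :
  (forall w, 2 * '<p, w> = koszul u v w) -> p = L u v.
Proof.
move=> pP; apply: dot_inj => w; apply: (@mulfI _ 2); first by rewrite pnatr_eq0.
by rewrite pP levi_civitaP.
Qed.

End Malcev.

(* Main.v *)
Require Import Defs.
From HB Require Import structures.
From mathcomp Require Import all_boot all_order all_algebra.
From mathcomp Require Import all_classical all_reals.
From mathcomp Require Import ring lra.

Set Implicit Arguments.
Unset Strict Implicit.
Unset Printing Implicit Defensive.

Import Order.TTheory GRing.Theory Num.Theory.
Local Open Scope ring_scope.

(** Write L for the Levi-Civita product, D for the derived ideal and P for its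
    orthogonal complement.

    Suppose that the curvature vanishes. Each L_u is skew-symmetric, and K = 0
    expresses L_([[u,v],w]) as a combination of products of such operators.
    Take the trace: the left-hand side is skew, so it contributes 0, and the two
    triple products cancel by cyclicity. What remains says that the trace form
    tau(u, v) = tr(L_u L_v) is invariant,
    tau([u,w],v) + tau(u,[v,w]) = 0 ([trace_form_invariant]). Since L_u is skew,
    tau(u, u) = - |L_u|^2, so tau is negative semidefinite and its isotropic
    vectors are exactly the u with L_u = 0. Invariance then gives
    tau([u,v],[u,v]) = - tau(u,[[u,v],v]), so L_([u,v]) = 0 as soon as
    L_([[u,v],v]) = 0 ([rho_br_eq0]). Solvability makes L vanish on a late term
    of the derived series, and this implication carries the vanishing up the
    series to D ([rho_brackv_eq0], [solvable_rho_derived_eq0]). The argument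
    applies to every linear skew family satisfying the identity K = 0.

    Once L is zero on D, torsion-freeness L_u v - L_v u = [u,v] makes D
    abelian, and the Koszul formula for L_d, d in D, evaluated on P and D, gives
    both that P is abelian and that ad_u is skew for u in P
    ([flat_structure]).

    Conversely, for such a decomposition the Koszul formula gives L_u = ad_u for
    u in P and L_d = 0 for d in D, so K(u,v,w) reduces to
    ad_v ad_u ad_w - ad_w ad_v ad_u on the components in P, and it is enough
    that these operators commute. For commuting u, v the Malcev identity says
    that ad_u, hence by symmetry ad_v, kills c = [ad_u, ad_v] x; as ad_u and
    ad_v are skew, <c, c> = 0 ([malcev_commuting_skew_ads]).

    Finally, the operators ad_u, u in P, form a commuting family of skew
    operators on D. Their common kernel in D is zero, because a vector killed
    by all of them is orthogonal to every bracket. Such a family only exists in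
    even dimension ([commuting_skew_even]): restricting to the kernel of
    one member lowers the dimension by its rank, which is even. *)

(** * Traces and parity for skew-symmetric operators *)

Section EuclideanSpace.
Variables (R : realType) (M : vectType R) (ip : {dot M for idfun}).
Implicit Types (x y z : M) (f g h : 'End(M)) (U V : {vspace M}).

Local Notation "'< u , v >" := (ip u v)
  (v at level 69, format "''<' u ,  v >").

Lemma dotC x y : '<x, y> = '<y, x>.
Proof. by rewrite hermC expr0 mul1r. Qed.

Lemma dotZl a x y : '<a *: x, y> = a * '<x, y>.
Proof. by rewrite linearZl_LR. Qed.

Lemma dotZr a x y : '<x, a *: y> = a * '<x, y>.
Proof. by rewrite dotC dotZl dotC. Qed.

Lemma dotDl x y z : '<x + y, z> = '<x, z> + '<y, z>.
Proof. exact: linearDl. Qed.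

Lemma dotDr x y z : '<x, y + z> = '<x, y> + '<x, z>.
Proof. by rewrite dotC dotDl !(dotC x). Qed.

Lemma dotBl x y z : '<x - y, z> = '<x, z> - '<y, z>.
Proof. exact: linearBl. Qed.

Lemma dotNl x y : '<- x, y> = - '<x, y>.
Proof. exact: linearNl. Qed.

Lemma dot0l x : '<0, x> = 0.
Proof. exact: linear0l. Qed.

Lemma dot0r x : '<x, 0> = 0.
Proof. by rewrite dotC dot0l. Qed.

Lemma dot_suml I (r : seq I) (F : I -> M) y :
  '<\sum_(i <- r) F i, y> = \sum_(i <- r) '<F i, y>.
Proof. exact: linear_sumlz. Qed.

Lemma dot_sumr I (r : seq I) (F : I -> M) y :
  '<y, \sum_(i <- r) F i> = \sum_(i <- r) '<y, F i>.
Proof. by rewrite dotC dot_suml; apply: eq_bigr => i _; rewrite dotC. Qed.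

Lemma orthoP V x : reflect {in V, forall y, '<x, y> = 0} (x \in orthov ip V).
Proof. exact: mem_orthovP. Qed.

Lemma ortho1E x y : (x \in orthov ip <[y]>) = ('<x, y> == 0).
Proof. exact: mem_orthov1. Qed.

Lemma dot_eq0 x : '<x, x> = 0 -> x = 0.
Proof.
move=> xx; apply/eqP; apply: contraPT isT => /(neq0_dnorm_gt0 (s := ip)).
by rewrite xx ltxx.
Qed.

Lemma dot_ge0 x : 0 <= '<x, x>.
Proof.
have [->|/(neq0_dnorm_gt0 (s := ip))/ltW//] := eqVneq x 0.
by rewrite dot0l.
Qed.

(** The traces and projections below rest on Parseval's expansion alone, the
    feature of an orthonormal basis kept here. *)
Definition parseval_frame (U : {vspace M}) (s : seq M) : Prop :=
  {subset s <= U} /\ {in U, forall x, x = \sum_(e <- s) '<x, e> *: e}.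

Lemma parseval_frame_exists U : exists s, parseval_frame U s.
Proof.
have [n] := ubnP (\dim U); elim: n => // n IH in U *; rewrite ltnS => dimU.
have [->|U0] := eqVneq U 0%VS.
  by exists [::]; split=> // x; rewrite memv0 big_nil => /eqP.
have [u Uu uu] : exists2 u, u \in U & '<u, u> = 1.
  have p0 : vpick U != 0 by rewrite vpick0.
  have pp := neq0_dnorm_gt0 (s := ip) _ p0.
  exists ((Num.sqrt '<vpick U, vpick U>)^-1 *: vpick U).
    by rewrite memvZ ?memv_pick.
  rewrite dotZl dotZr mulrA -expr2 exprVn sqr_sqrtr ?ltW//.
  by rewrite mulVf // gt_eqF.
have [] := IH (U :&: orthov ip <[u]>)%VS.
  rewrite -eq_dim_orthov1; last first.
    by apply/orthoP => /(_ u Uu)/eqP; rewrite uu oner_eq0.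
  by rewrite (leq_trans _ dimU) // ltn_predL lt0n dimv_eq0.
move=> s [sU sP]; exists (u :: s); split.
  by move=> e /[!inE] /predU1P[->//|/sU]; rewrite memv_cap => /andP[].
move=> x Ux; rewrite big_cons.
have Uy : x - '<x, u> *: u \in (U :&: orthov ip <[u]>)%VS.
  rewrite memv_cap rpredB ?rpredZ//= ortho1E dotBl dotZl uu mulr1.
  by rewrite subrr.
rewrite -{1}(subrK ('<x, u> *: u) x) addrC {1}(sP _ Uy); congr (_ + _).
apply: eq_big_seq => e /sU; rewrite memv_cap ortho1E => /andP[_ /eqP eu].
by rewrite dotBl dotZl dotC (dotC u) eu mulr0 subr0 dotC.
Qed.

(** The frame expansion of U, applied to an arbitrary vector, is the
    orthogonal projection onto U. *)
Lemma orthov_decomp U :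
  (orthov ip U + U = fullv)%VS /\ directv (orthov ip U + U).
Proof.
split.
  apply/eqP; rewrite eqEsubv subvf; apply/subvP => x _.
  have [s [sU sP]] := parseval_frame_exists U.
  pose p := \sum_(e <- s) '<x, e> *: e.
  have Up : p \in U by rewrite /p big_seq rpred_sum // => e /sU; apply: rpredZ.
  rewrite -(subrK p x) memv_add //; apply/orthoP => y Uy.
  rewrite dotBl {1}(sP y Uy) dot_sumr dot_suml -sumrB big1 // => e _.
  by rewrite dotZl dotZr (dotC e) mulrC subrr.
apply/directv_addP/eqP; rewrite -subv0; apply/subvP => x.
by rewrite memv_cap memv0 => /andP[/orthoP xU /xU /dot_eq0 ->].
Qed.

Definition ftrace (s : seq M) f : R := \sum_(e <- s) '<f e, e>.

Lemma ftraceD s f g : ftrace s (f + g) = ftrace s f + ftrace s g.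
Proof.
by rewrite /ftrace -big_split; apply: eq_bigr => e _; rewrite lfunE/= dotDl.
Qed.

Lemma ftraceN s f : ftrace s (- f) = - ftrace s f.
Proof.
by rewrite /ftrace -sumrN; apply: eq_bigr => e _; rewrite lfunE/= dotNl.
Qed.

(** Expanding along the frame turns both sides into the same double sum. *)
Lemma ftraceC s f g : parseval_frame fullv s ->
  ftrace s (f \o g)%VF = ftrace s (g \o f)%VF.
Proof.
move=> [_ sP]; have sE x : x = \sum_(e <- s) '<x, e> *: e.
  by apply: sP; rewrite memvf.
have trE (a b : 'End(M)) :
    ftrace s (a \o b)%VF = \sum_(e <- s) \sum_(e' <- s) '<b e, e'> * '<a e', e>.
  apply: eq_bigr => e _; rewrite lfunE/= {1}(sE (b e)) linear_sum dot_suml.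
  by apply: eq_bigr => e' _; rewrite linearZ/= dotZl.
rewrite !trE exchange_big; apply: eq_bigr => e _; apply: eq_bigr => e' _.
exact: mulrC.
Qed.

Lemma ftrace_skew s f : skew_wrt ip f -> ftrace s f = 0.
Proof.
move=> fS; apply: big1 => e _; have := fS e e; rewrite (dotC e); lra.
Qed.

(** For skew f the trace of f^2 is - sum |f e|^2. *)
Lemma skew_ftrace_sqr_eq0 s f : parseval_frame fullv s -> skew_wrt ip f ->
  ftrace s (f \o f)%VF = 0 -> f = 0.
Proof.
move=> [_ sP] fS.
have -> : ftrace s (f \o f)%VF = - \sum_(e <- s) '<f e, f e>.
  by rewrite -sumrN; apply: eq_bigr => e _; rewrite lfunE/= fS.
move/eqP; rewrite oppr_eq0 psumr_eq0; last by move=> e _; exact: dot_ge0.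
move/allP => fe0; apply/lfunP => x; rewrite (sP x (memvf x)) linear_sum.
rewrite big_seq big1 ?lfunE// => e /fe0 /eqP/dot_eq0 fe.
by rewrite linearZ/= fe scaler0.
Qed.

(** The Gram matrix of the alternating form <f x, y> on a basis of U is an
    invertible antisymmetric matrix of size n, so that
    det A = (-1)^n det A with det A <> 0. *)
Lemma skew_nondegenerate_even f U : skew_wrt ip f ->
  (forall x, x \in U -> {in U, forall y, '<f x, y> = 0} -> x = 0) ->
  ~~ odd (\dim U).
Proof.
move=> fS nd; set n := \dim U.
pose A : 'M[R]_n := \matrix_(i, j) '<f (vbasis U)`_i, (vbasis U)`_j>.
have AT : A^T = -1 *: A.
  by apply/matrixP => i j; rewrite !mxE fS dotC mulN1r.
have Au : A \in unitmx.
  rewrite -row_free_unit -kermx_eq0; apply/rowV0P => v /sub_kermxP vA.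
  pose x := \sum_(i < n) v 0 i *: (vbasis U)`_i.
  have Ui (i : 'I_n) : (vbasis U)`_i \in U.
    by rewrite vbasis_mem ?mem_nth ?size_tuple.
  have Ux : x \in U by rewrite rpred_sum // => i _; rewrite rpredZ.
  have x0 : x = 0.
    apply: nd => // y /coord_vbasis ->; rewrite dot_sumr big1 // => j _ /=.
    rewrite dotZr linear_sum dot_suml.
    have /matrixP/(_ 0 j) := vA; rewrite !mxE => vAj.
    rewrite -[X in _ * X](_ : 0 = _) ?mulr0 // -[LHS]vAj.
    by apply: eq_bigr => i _; rewrite mxE linearZ/= dotZl.
  have /freeP fr := basis_free (vbasisP U).
  by apply/rowP => i; rewrite mxE; apply: fr.
have := det_tr A; rewrite AT detZ -signr_odd; case: odd => //=.
rewrite expr1 mulN1r => /eqP; rewrite eq_sym -addr_eq0 -mulr2n.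
rewrite mulrn_eq0/= => /eqP A0; move: Au.
by rewrite unitmxE A0 unitr0.
Qed.

(** By rank-nullity dim U = dim (U :&: ker f) + dim f(U). The other operators
    preserve the kernel of f, so induction applies to the first term; f is
    injective on f(U), so the form <f x, y> is nondegenerate there. *)
Lemma commuting_skew_even (fs : seq 'End(M)) U :
  {in fs, forall f, skew_wrt ip f} ->
  {in fs & U, forall f x, f x \in U} ->
  {in fs &, forall f g, {in U, forall x, f (g x) = g (f x)}} ->
  {in U, forall x, {in fs, forall f, f x = 0} -> x = 0} ->
  ~~ odd (\dim U).
Proof.
elim: fs U => [|f fs IH] U fsS fsU fsC ker0.
  have -> : U = 0%VS.
    by apply/eqP; rewrite -subv0; apply/subvP => x /ker0->//; rewrite mem0v.
  by rewrite dimv0.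
have fS : skew_wrt ip f by apply: fsS; rewrite mem_head.
have fsl g : g \in fs -> g \in f :: fs by move=> gfs; rewrite in_cons gfs orbT.
rewrite -(limg_ker_dim f U) oddD negb_add.
have /negbTE-> : ~~ odd (\dim (U :&: lker f)).
  apply: IH.
  - by move=> g /fsl; exact: fsS.
  - move=> g x gfs; rewrite !memv_cap !memv_ker => /andP[Ux /eqP fx].
    by rewrite fsU ?fsl// fsC ?mem_head ?fsl// fx linear0/=.
  - by move=> g h /fsl gl /fsl hl x /[!memv_cap]/andP[Ux _]; exact: fsC.
  - move=> x; rewrite memv_cap memv_ker => /andP[Ux /eqP fx] gx.
    by apply: ker0 => // g /predU1P[->//|]; exact: gx.
rewrite eq_sym eqbF_neg; apply: (skew_nondegenerate_even fS).
move=> _ /memv_imgP[x Ux ->] ffx; apply: dot_eq0; rewrite fS.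
have /dot_eq0-> : '<f (f x), f (f x)> = 0.
  by apply: ffx; rewrite memv_img // fsU ?mem_head.
by rewrite dot0r oppr0.
Qed.

End EuclideanSpace.

Arguments dotC {R M ip}.

(** * Skew representations of solvable algebras *)

Section Malcev.
Variables (R : realType) (M : vectType R) (br : {bilinear M -> M -> M}).
Implicit Types (u v w x y : M) (U V N : {vspace M}).

Local Notation "'[ u , v ]" := (br u v)
  (format "''[' u ,  v ]").

(** For rho = L this is the vanishing of the curvature, solved for its first
    term. *)
Definition malcev_representation (E : vectType R) (rho : M -> 'End(E)) : Prop :=
  forall u v w,
  rho '['[u, v], w] =
    (rho '[u, w] \o rho v)%VF + (rho u \o rho '[v, w])%VF
    - (rho v \o (rho u \o rho w))%VF + (rho w \o (rho v \o rho u))%VF.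

Lemma derived_series_subS n :
  (derived_series br n.+1 <= derived_series br n)%VS.
Proof.
elim: n => [|n IH]; first exact: subvf.
apply: brackv_sub => u v Uu Uv; apply: mem_brackv; exact: subvP IH _ _.
Qed.

Section SkewRepresentation.
Variables (E : vectType R) (ip : {dot E for idfun}).
Variables (rho : {linear M -> 'End(E)}).
Hypothesis brC : forall u v, '[u, v] = - '[v, u].
Hypothesis rho_skew : forall u, skew_wrt ip (rho u).
Hypothesis rho_rep : malcev_representation rho.

Definition trace_form s u v : R := ftrace ip s (rho u \o rho v)%VF.

(** The trace of the representation identity: rho [[u,v],w] is skew, and the
    two triple products are cyclic permutations of each other. *)
Lemma trace_form_invariant s u v w : parseval_frame ip fullv s ->
  trace_form s '[u, w] v + trace_form s u '[v, w] = 0.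
Proof.
move=> sP; have := ftrace_skew s (rho_skew '['[u, v], w]).
rewrite rho_rep !ftraceD ftraceN (ftraceC (rho w)) // comp_lfunA.
by rewrite addrNK.
Qed.

Lemma trace_form_eq0 s u : parseval_frame ip fullv s ->
  trace_form s u u = 0 -> rho u = 0.
Proof. by move=> sP; exact: skew_ftrace_sqr_eq0. Qed.

(** Invariance gives tau([u,v],[u,v]) = - tau(u, [[u,v],v]) = 0, and tau is
    definite modulo the kernel of rho. *)
Lemma rho_br_eq0 u v : rho '['[u, v], v] = 0 -> rho '[u, v] = 0.
Proof.
have [s sP] := parseval_frame_exists ip fullv; move=> r0.
apply: (trace_form_eq0 sP); have := trace_form_invariant u '[u, v] v sP.
rewrite {2}/trace_form r0 comp_lfun0r /ftrace [X in _ + X]big1 ?addr0 //.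
by move=> e _; rewrite lfunE/= dot0l.
Qed.

(** One step up the derived series, by two applications of [rho_br_eq0]: with
    D = [U,U], first [[x,d],d] lies in [D,D] for x in U and d in D, so rho
    vanishes on [U,D]; then [[x,y],y] lies in [D,U] for x, y in U. Asking
    for a subalgebra U, not an ideal, keeps the induction free of the question
    whether the terms of the derived series are ideals. *)
Lemma rho_brackv_eq0 U : (brackv br U U <= U)%VS ->
  {in brackv br (brackv br U U) (brackv br U U), forall d, rho d = 0} ->
  {in brackv br U U, forall d, rho d = 0}.
Proof.
move=> subU; set D := brackv br U U => r0.
have rD : {in U & D, forall x d, rho '[x, d] = 0}.
  move=> x d Ux Dd; apply: rho_br_eq0; apply: r0.
  by rewrite !mem_brackv // (subvP subU).
have sub : (D <= lker (linfun rho))%VS.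
  apply: brackv_sub => x y Ux Uy; rewrite memv_ker lfunE/=; apply/eqP.
  by apply: rho_br_eq0; rewrite brC linearN rD ?oppr0 // mem_brackv.
by move=> d /(subvP sub); rewrite memv_ker lfunE => /eqP.
Qed.

Lemma solvable_rho_derived_eq0 : is_solvable br ->
  {in derived_ideal br, forall d, rho d = 0}.
Proof.
case=> n sn; have : {in derived_series br n.+1, forall d, rho d = 0}.
  move=> d /(subvP (derived_series_subS n)); rewrite sn memv0 => /eqP->.
  exact: linear0.
elim: n {sn} => [//|n IH] r0; apply: IH; apply: rho_brackv_eq0 => //.
exact: derived_series_subS.
Qed.

End SkewRepresentation.

(** * The Levi-Civita product and flatness *)

Section LeviCivita.
Variable (ip : {dot M for idfun}).

Local Notation "'< u , v >" := (ip u v)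
  (v at level 69, format "''<' u ,  v >").
Local Notation L := (levi_civita br ip).
Local Notation D := (derived_ideal br).
Local Notation Dperp := (orthov ip D).

Lemma levi_civita_is_linear u : linear (L u).
Proof.
move=> a x y; apply/esym/levi_civita_unique => w.
rewrite dotDl dotZl mulrDr mulrCA !levi_civitaP /koszul !(linearPr, linearPl)/=.
by rewrite /GRing.scale/=; ring.
Qed.

HB.instance Definition _ u :=
  GRing.isLinear.Build _ _ _ _ (L u) (levi_civita_is_linear u).

Definition levi_civita_lfun u : 'End(M) := linfun (L u).

Lemma levi_civita_lfunE u x : levi_civita_lfun u x = L u x.
Proof. exact: lfunE. Qed.

Lemma levi_civita_lfun_is_linear : linear levi_civita_lfun.
Proof.
move=> a u v; apply/lfunP => x.
rewrite add_lfunE scale_lfunE !levi_civita_lfunE.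
apply/esym/levi_civita_unique => w.
rewrite dotDl dotZl mulrDr mulrCA !levi_civitaP /koszul !(linearPr, linearPl)/=.
by rewrite /GRing.scale/=; ring.
Qed.

HB.instance Definition _ :=
  GRing.isLinear.Build _ _ _ _ levi_civita_lfun levi_civita_lfun_is_linear.

Lemma levi_civitaDl u v x : L (u + v) x = L u x + L v x.
Proof.
have := congr1 (fun f : 'End(M) => f x) (linearD levi_civita_lfun u v).
by rewrite add_lfunE !levi_civita_lfunE.
Qed.

Lemma br_derived u v : '[u, v] \in D.
Proof. by rewrite mem_brackv ?memvf. Qed.

Lemma derived_split x : exists p d, [/\ p \in Dperp, d \in D & x = p + d].
Proof.
have := memvf x; rewrite -(orthov_decomp ip D).1 => /memv_addP[p Dp [d Dd ->]].
by exists p, d.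
Qed.

Lemma dot_orthoD u d : u \in Dperp -> d \in D -> '<u, d> = 0.
Proof. by move=> /orthoP; exact. Qed.

Lemma dot_Dortho u d : u \in Dperp -> d \in D -> '<d, u> = 0.
Proof. by rewrite dotC; exact: dot_orthoD. Qed.

Hypothesis brC : forall u v, '[u, v] = - '[v, u].

Lemma levi_civita_skew u : skew_wrt ip (L u).
Proof.
move=> v w; apply: (@mulfI _ 2); first by rewrite pnatr_eq0.
rewrite mulrN (dotC v) !levi_civitaP /koszul.
rewrite (brC w v) (brC v u) (brC u w) !dotNl; ring.
Qed.

Lemma levi_civita_torsion_free u v : L u v - L v u = '[u, v].
Proof.
apply: (dot_inj (ip := ip)) => w.
apply: (@mulfI _ 2); first by rewrite pnatr_eq0.
rewrite dotBl mulrBr !levi_civitaP /koszul.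
rewrite (brC v u) (brC u w) (brC w v) !dotNl; ring.
Qed.

Lemma flat_levi_civita_derived : is_solvable br -> is_flat br ip ->
  forall d x, d \in D -> L d x = 0.
Proof.
move=> sol flat d x Dd; have skewL u : skew_wrt ip (levi_civita_lfun u).
  by move=> v w; rewrite !levi_civita_lfunE; exact: levi_civita_skew.
have rep : malcev_representation levi_civita_lfun.
  move=> u v w; apply/lfunP => z; apply/eqP; rewrite -subr_eq0; apply/eqP.
  rewrite -[RHS](flat u v w z) /curvature.
  rewrite !(add_lfunE, opp_lfunE, comp_lfunE, levi_civita_lfunE).
  by rewrite !opprD !opprK !addrA.
have := solvable_rho_derived_eq0 brC skewL rep sol Dd.
by move=> /(congr1 (fun f : 'End(M) => f x)); rewrite levi_civita_lfunE lfunE.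
Qed.

(** All three conclusions are read off from the vanishing of the Koszul
    expression at d in D. For u, w in P it reduces at d = [u,w] to -|[u,w]|^2;
    for u in P and e in D it reduces to the skewness of ad_u on the pair
    (d, e), and the components in P do not contribute since P is abelian and
    orthogonal to all brackets. *)
Lemma flat_structure : is_solvable br -> is_flat br ip ->
  [/\ abelian_subspace br Dperp, abelian_subspace br D &
      {in Dperp, forall u, skew_wrt ip (br u)}].
Proof.
move=> sol flat; have LD0 := flat_levi_civita_derived sol flat.
have K0 d v w : d \in D -> koszul br ip d v w = 0.
  by move=> Dd; rewrite -levi_civitaP LD0 // dot0l mulr0.
have abP : abelian_subspace br Dperp.
  move=> u w Pu Pw; apply: (@dot_eq0 _ _ ip).
  have := K0 _ u w (br_derived u w).
  rewrite /koszul (dot_Dortho Pw) ?br_derived// (dot_Dortho Pu) ?br_derived//.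
  by rewrite sub0r addr0 => /eqP; rewrite oppr_eq0 => /eqP.
have abD : abelian_subspace br D.
  by move=> a b Da Db; rewrite -levi_civita_torsion_free !LD0 // subrr.
split=> // u Pu v w.
have [p [d [Pp Dd ->]]] := derived_split v.
have [q [e [Pq De ->]]] := derived_split w.
rewrite !(linearDr br)/= (abP _ _ Pu Pp) (abP _ _ Pu Pq) !add0r dotC !dotDl.
rewrite (dot_orthoD Pq) ?br_derived// (dot_orthoD Pp) ?br_derived// !add0r.
have := K0 d u e Dd; rewrite /koszul (abD _ _ De Dd) dot0l addr0 (brC d) dotNl.
rewrite (dotC e) (dotC d) => /eqP; rewrite subr_eq0 => /eqP <-.
by rewrite opprK.
Qed.

(** * From the orthogonal splitting back to flatness *)

Section Structure.
Hypothesis abP : abelian_subspace br Dperp.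
Hypothesis abD : abelian_subspace br D.
Hypothesis skewP : {in Dperp, forall u, skew_wrt ip (br u)}.

Lemma levi_civita_orthoE u x : u \in Dperp -> L u x = '[u, x].
Proof.
move=> Pu; apply/esym/levi_civita_unique => w.
rewrite /koszul (dot_Dortho Pu) ?br_derived// (brC w) dotNl (skewP Pu w x).
rewrite (dotC w); ring.
Qed.

Lemma levi_civita_derived_eq0 d x : d \in D -> L d x = 0.
Proof.
move=> Dd; apply/esym/levi_civita_unique => w; rewrite dot0l mulr0 /koszul.
have [p [e [Pp De ->]]] := derived_split x.
have [q [f [Pq Df ->]]] := derived_split w.
rewrite !(linearDr br, linearDl br)/= (abP Pp Pq).
rewrite (abD Dd De) (abD De Df) (abD Df Dd) !(addr0, add0r).
rewrite !(dotDl, dotDr).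
rewrite (dot_Dortho Pq) ?br_derived// (dot_Dortho Pp) ?br_derived//.
rewrite (brC d) (brC e) !dotNl (skewP Pp d f) (skewP Pq d e).
rewrite (dotC d) (dotC d); ring.
Qed.

Hypothesis malcev : is_malcev br.

(** With [u,v] = 0 the Malcev identity J(u,x,[u,v]) = [J(u,x,v),u] has zero
    left-hand side, while J(u,x,v) is the commutator of ad_u and ad_v at x. *)
Lemma malcev_commuting_ads_defect u v x : '[u, v] = 0 ->
  '[u, '[u, '[v, x]] - '[v, '[u, x]]] = 0.
Proof.
move=> uv0; have vu0 : '[v, u] = 0 by rewrite brC uv0 oppr0.
have := malcev.2 u x v; rewrite uv0 /jacobian vu0.
rewrite !(linear0r br, linear0l br) !addr0.
rewrite (brC x v) (brC _ u) (brC '[u, x]) (brC (- _) u).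
rewrite (linearNr br) opprK addrC.
by move/esym/eqP; rewrite oppr_eq0 => /eqP.
Qed.

(** The commutator c of the two operators at x is killed by both of them, and
    moving ad_u and ad_v across <c, c> makes them act on c. *)
Lemma malcev_commuting_skew_ads u v x :
  skew_wrt ip (br u) -> skew_wrt ip (br v) -> '[u, v] = 0 ->
  '[u, '[v, x]] = '[v, '[u, x]].
Proof.
move=> uS vS uv0; have vu0 : '[v, u] = 0 by rewrite brC uv0 oppr0.
apply/eqP; rewrite -subr_eq0; apply/eqP/(@dot_eq0 _ _ ip).
set c := '[u, _] - _ in |- *; rewrite {1}/c dotBl (uS _ c) (vS _ c).
have -> : '[u, c] = 0 by exact: malcev_commuting_ads_defect.
have -> : '[v, c] = 0.
  by rewrite /c -opprB linearN/= malcev_commuting_ads_defect ?oppr0.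
by rewrite !dot0r subrr.
Qed.

(** L_z depends only on the component of z in P, where it is the adjoint
    operator. *)
Lemma structure_flat : is_flat br ip.
Proof.
move=> u v w x; rewrite /curvature.
have LE z y : exists2 p, p \in Dperp & forall y, L z y = '[p, y].
  have [p [d [Pp Dd ->]]] := derived_split z; exists p => // t.
  by rewrite levi_civitaDl levi_civita_orthoE // levi_civita_derived_eq0 ?addr0.
have [a Pa aE] := LE u 0; have [b Pb bE] := LE v 0; have [c Pc cE] := LE w 0.
have comm p q y : p \in Dperp -> q \in Dperp -> '[p, '[q, y]] = '[q, '[p, y]].
  move=> Pp Pq; apply: malcev_commuting_skew_ads; rewrite ?abP //;
    exact: skewP.
have LD y z t : L '[y, z] t = 0 by rewrite levi_civita_derived_eq0 ?br_derived.
rewrite !LD !(linear0, addr0, add0r) !(aE, bE, cE).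
by rewrite (comm a c) // (comm b c) // subrr.
Qed.

Lemma structure_even_dim : ~~ odd (\dim D).
Proof.
pose fs := [seq linfun (br u) | u <- vbasis Dperp].
have fsP f : f \in fs -> exists2 u, u \in Dperp & forall x, f x = '[u, x].
  by move=> /mapP[u /vbasis_mem Pu ->]; exists u => // x; rewrite lfunE.
apply: (commuting_skew_even (ip := ip) (fs := fs)).
- by move=> f /fsP[u Pu fE] x y; rewrite !fE; exact: skewP.
- by move=> f x /fsP[u Pu fE] _; rewrite fE br_derived.
- move=> f g /fsP[u Pu fE] /fsP[v Pv gE] x _; rewrite !(fE, gE).
  by apply: malcev_commuting_skew_ads; rewrite ?abP //; exact: skewP.
move=> x Dx x0.
have ux0 u : u \in Dperp -> '[u, x] = 0.
  move=> /coord_vbasis->; rewrite linear_sumlz big1 // => i _ /=.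
  have := x0 (linfun (br (vbasis Dperp)`_i)).
  rewrite lfunE/= => xi; rewrite linearZl_LR/= xi ?scaler0 //.
  by apply: map_f; rewrite mem_nth ?size_tuple.
(* A vector of D killed by every ad_u, u in P, is orthogonal to all brackets. *)
have : (D <= orthov ip <[x]>)%VS.
  apply: brackv_sub => y z _ _; rewrite ortho1E.
  have [p [d [Pp Dd ->]]] := derived_split y.
  have [q [e [Pq De ->]]] := derived_split z.
  rewrite !(linearDr br, linearDl br)/= (abP Pp Pq) (abD Dd De) add0r addr0.
  by rewrite (brC d) dotDl dotNl !skewP // !ux0 // !dot0r !oppr0 addr0.
by move=> /subvP/(_ _ Dx); rewrite ortho1E => /eqP/dot_eq0.
Qed.

End Structure.
End LeviCivita.
End Malcev.

Unset Implicit Arguments.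

Theorem theorem2p21 (R : realType) (M : vectType R)
    (br : {bilinear M -> M -> M}) (ip : {dot M for idfun})
    (hmalcev : is_malcev br) (hsolv : is_solvable br) :
  let D := derived_ideal br in
  let Dperp := orthov ip D in
  (is_flat br ip <->
    [/\ (Dperp + D = fullv)%VS /\ directv (Dperp + D),
        abelian_subspace br Dperp,
        abelian_subspace br D &
        {in Dperp, forall u, skew_wrt ip (br u)}])
  /\ (is_flat br ip -> ~~ odd (\dim D)).
Proof.
move=> D Dperp; have brC := hmalcev.1; split; [split|] => [flat||flat].
- have [abP abD skewP] := flat_structure brC hsolv flat.
  by split=> //; exact: orthov_decomp.
- by case=> _ abP abD skewP; exact: structure_flat brC abP abD skewP hmalcev.
- have [abP abD skewP] := flat_structure brC hsolv flat.
  exact: structure_even_dim brC abP abD skewP hmalcev.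
Qed.
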